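(* Let $p\ge1$, $r_1\le\cdots\le r_p$ nonnegative integers, $\mathbf{r}_p=(r_1,\ldots,r_p)$, and $m\ge0$ an integer. Then, as formal power series in $t$, $$\sum_{n\ge0}B_{n+m}(z;\mathbf{r}_p)\frac{t^n}{n!}=B_m(ze^t;\mathbf{r}_p)\exp\big(z(e^t-1)+r_pt\big)=\sum_{k=0}^{|\mathbf{r}_{p-1}|}a_k(\mathbf{r}_{p-1})\frac{d^{m+k}}{dt^{m+k}}\exp\big(z(e^t-1)+r_pt\big).$$
   Context: $|\mathbf{r}_p|=r_1+\cdots+r_p$, $|\mathbf{r}_{p-1}|=r_1+\cdots+r_{p-1}$. With $R_1=\{1,\ldots,r_1\}$, $R_2=\{r_1+1,\ldots,r_1+r_2\}$, ..., ${N\brace k}_{\mathbf{r}_p}$ is the number of partitions of $\{1,\ldots,N\}$ into $k$ nonempty blocks such that for each $i$ the elements of $R_i$ lie in distinct blocks, and $B_n(z;\mathbf{r}_p)=\sum_{k=0}^{n+|\mathbf{r}_{p-1}|}{n+|\mathbf{r}_p|\brace k+r_p}_{\mathbf{r}_p}z^k$. With $\genfrac{[}{]}{0pt}{}{n}{k}$ the unsigned Stirling numbers of the first kind, $a_k(\mathbf{r}_{p-1})=(-1)^{|\mathbf{r}_{p-1}|-k}\sum_{j_1+\cdots+j_{p-1}=k}\genfrac{[}{]}{0pt}{}{r_1}{j_1}\cdots\genfrac{[}{]}{0pt}{}{r_{p-1}}{j_{p-1}}$, i.e. $\sum_k a_k(\mathbf{r}_{p-1})u^k=u^{\underline{r_1}}\cdots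 u^{\underline{r_{p-1}}}$. *)

(* Defs.v *)
From HB Require Import structures.
From mathcomp Require Import all_boot all_order all_fingroup all_algebra.
From mathcomp Require Import boolp.

Set Implicit Arguments.
Unset Strict Implicit.
Unset Printing Implicit Defensive.

Import GRing.Theory.
Local Open Scope ring_scope.

(* Formal power series in one variable t: [f n] is the coefficient of t^n.    *)
(* Wrapping the function keeps the Cauchy product apart from the pointwise    *)
(* ring structure on functions.                                               *)
Record fps (R : Type) := Fps { fps_coef :> nat -> R }.

HB.instance Definition _ (R : Type) := gen_eqMixin (fps R).
HB.instance Definition _ (R : Type) := gen_choiceMixin (fps R).

Lemma fpsP (R : Type) (f g : fps R) : (forall n, f n = g n) -> f = g.
Proof. by case: f g => [f] [g] /= fg; congr Fps; apply: funext. Qed.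

Section FpsZmod.
Variable V : zmodType.
Implicit Types f g h : fps V.

Definition fps_zero : fps V := Fps (fun=> 0).
Definition fps_opp f : fps V := Fps (fun n => - f n).
Definition fps_add f g : fps V := Fps (fun n => f n + g n).

Lemma fps_addA : associative fps_add.
Proof. by move=> f g h; apply: fpsP => n /=; rewrite addrA. Qed.
Lemma fps_addC : commutative fps_add.
Proof. by move=> f g; apply: fpsP => n /=; rewrite addrC. Qed.
Lemma fps_add0 : left_id fps_zero fps_add.
Proof. by move=> f; apply: fpsP => n /=; rewrite add0r. Qed.
Lemma fps_addN : left_inverse fps_zero fps_opp fps_add.
Proof. by move=> f; apply: fpsP => n /=; rewrite addNr. Qed.

HB.instance Definition _ :=
  GRing.isZmodule.Build (fps V) fps_addA fps_addC fps_add0 fps_addN.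

End FpsZmod.

Section FpsRing.
Variable R : comNzRingType.
Implicit Types (f g h : fps R) (a : R).

Definition fpsC a : fps R := Fps (fun n => if n == 0%N then a else 0).
Definition fpsT : fps R := Fps (fun n => (n == 1%N)%:R).
Definition fps_mul f g : fps R :=
  Fps (fun n => \sum_(i < n.+1) f i * g (n - i)%N).

Let trunc N f : {poly R} := \poly_(i < N) f i.

Let fps_mul_trunc N f g n :
  (n < N)%N -> fps_mul f g n = (trunc N f * trunc N g)`_n.
Proof.
move=> nN; rewrite coefM /=; apply: eq_bigr => i _.
rewrite !coef_poly (leq_ltn_trans (leq_subr _ _) nN).
by rewrite (leq_ltn_trans _ nN) // -ltnS.
Qed.

Lemma fps_mulA : associative fps_mul.
Proof.
move=> f g h; apply: fpsP => n.
transitivity ((trunc n.+1 f * (trunc n.+1 g * trunc n.+1 h))`_n).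
  rewrite coefM; apply: eq_bigr => i _.
  by rewrite (@fps_mul_trunc n.+1) ?ltnS ?leq_subr // {2}/trunc coef_poly ltn_ord.
rewrite mulrA coefM; apply/esym/eq_bigr => i _.
by rewrite (@fps_mul_trunc n.+1) // {3}/trunc coef_poly ltnS leq_subr.
Qed.

Lemma fps_mulC : commutative fps_mul.
Proof.
by move=> f g; apply: fpsP => n; rewrite !(@fps_mul_trunc n.+1) // mulrC.
Qed.

Lemma fps_mul1 : left_id (fpsC 1) fps_mul.
Proof.
move=> f; apply: fpsP => n /=; rewrite big_ord_recl /= mul1r subn0.
by rewrite big1 ?addr0 // => i _; rewrite mul0r.
Qed.

Lemma fps_mulDl : left_distributive fps_mul +%R.
Proof.
move=> f g h; apply: fpsP => n /=; rewrite -big_split /=.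
by apply: eq_bigr => i _; rewrite mulrDl.
Qed.

Lemma fpsC1_neq0 : fpsC 1 != 0.
Proof. by apply/eqP => /(congr1 (fun f => f 0%N)) /=; apply/eqP/oner_neq0. Qed.

HB.instance Definition _ := GRing.Zmodule_isComNzRing.Build (fps R)
  fps_mulA fps_mulC fps_mul1 fps_mulDl fpsC1_neq0.

Definition fps_deriv f : fps R := Fps (fun n => f n.+1 *+ n.+1).

End FpsRing.

Arguments fpsT {R}.

Section FpsExp.
Variables (F : fieldType) (A : comAlgType F).

(* \sum_n u_n t^n / n!, for F of characteristic 0.                            *)
Definition egf (u : nat -> A) : fps A := Fps (fun n => (n`!%:R^-1 : F) *: u n).

(* exp f = \sum_k f^k / k!, meaningful only when the constant term of f is 0: *)
(* the coefficient of t^n in f^k then vanishes for k > n, so the truncation   *)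
(* of the sum loses nothing.                                                  *)
Definition fps_exp (f : fps A) : fps A :=
  Fps (fun n => \sum_(k < n.+1) (k`!%:R^-1 : F) *: (f ^+ k) n).

End FpsExp.

(* Number of permutations of n points with k cycles, fixed points included.   *)
Definition stirling1 (n k : nat) : nat :=
  #|[set s : 'S_n | #|porbits s| == k]|.

(* The ground set {1, ..., N} is represented by 'I_N, and R_1, ..., R_p by    *)
(* rblock r 0, ..., rblock r (p - 1).                                         *)
Definition rblock (N : nat) (r : seq nat) (i : nat) : {set 'I_N} :=
  [set x : 'I_N | (sumn (take i r) <= x < sumn (take i.+1 r))%N].

Definition rstirling2 (r : seq nat) (N k : nat) : nat :=
  #|[set P : {set {set 'I_N}} |
      [&& partition P [set: 'I_N], #|P| == k &
          [forall i : 'I_(size r), forall x in rblock N r i,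
             forall y in rblock N r i,
             (x != y) ==> (pblock P x != pblock P y)]]]|.

(* r_p, and the sequence (r_1, ..., r_{p-1}). *)
Definition rlast (r : seq nat) : nat := last 0%N r.
Definition rinit (r : seq nat) : seq nat := take (size r).-1 r.

(* The polynomial B_n(z; r) evaluated at an arbitrary element z of a          *)
(* commutative ring, be it a scalar, an indeterminate or a power series.      *)
Definition rbell (R : comNzRingType) (r : seq nat) (n : nat) (z : R) : R :=
  \sum_(k < (n + sumn (rinit r)).+1)
    z ^+ k *+ rstirling2 r (n + sumn r) (k + rlast r).

(* In a tuple with j_1 + ... + j_q = k each j_i is at most k, hence 'I_k.+1.  *)
Definition acoef (s : seq nat) (k : nat) : int :=
  (-1) ^+ (sumn s - k) *
  \sum_(j : {ffun 'I_(size s) -> 'I_k.+1} | (\sum_i j i)%N == k)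
     \prod_(i < size s) (stirling1 (nth 0%N s i) (j i))%:Z.

(* Main.v *)
Require Import Defs.
From HB Require Import structures.
From mathcomp Require Import all_boot all_order all_fingroup all_algebra.
From mathcomp Require Import boolp.
Set Implicit Arguments.
Unset Strict Implicit.
Unset Printing Implicit Defensive.
Import GRing.Theory.
Local Open Scope ring_scope.

(* Write E = exp(z(e^t-1) + at) with a = r_p, D = d/dt and w = z e^t. Since
   Dw = w and DE = (w + a)E, the operator (D-a)(D-a-1)...(D-a-k+1) sends E to
   w^k E. Counting maps from {1, ..., N} to an x-element set that are
   injective on each R_i, directly and through their kernel partitions, gives
     X^m X^{\underline r_1} ... X^{\underline r_{p-1}}
       = \sum_k {m+|r| \brace k+a} (X-a)^{\underline k};
   substituting D for X and applying the result to E yields the second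
   equality. Applying D^n to the right-hand side replaces m by n+m, so n! times
   the coefficient of t^n is the value at t = 0 of B_{n+m}(w) E, which is
   B_{n+m}(z). *)

(** * Formal power series *)

Section FpsCoef.
Variable V : zmodType.
Implicit Types f g : fps V.

Lemma fps_coefD f g n : (f + g) n = f n + g n.
Proof. by []. Qed.

Lemma fps_coefN f n : (- f) n = - f n.
Proof. by []. Qed.

Lemma fps_coef_sum (I : Type) (s : seq I) (P : pred I) (F : I -> fps V) n :
  (\sum_(i <- s | P i) F i) n = \sum_(i <- s | P i) F i n.
Proof. by apply: (big_morph (fun f : fps V => f n)). Qed.

Lemma fps_coefMn f k n : (f *+ k) n = f n *+ k.
Proof. by elim: k => // k IHk; rewrite !mulrS fps_coefD IHk. Qed.

Lemma fps_coefMz f (k : int) n : (f *~ k) n = f n *~ k.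
Proof.
by case: k => k; rewrite ?NegzE ?mulrNz ?fps_coefN -!pmulrn fps_coefMn.
Qed.

End FpsCoef.

Section FpsDeriv.
Variable R : comNzRingType.
Implicit Types f g : fps R.
Local Notation D := (@fps_deriv R).

Lemma fps_coefM f g n : (f * g) n = \sum_(i < n.+1) f i * g (n - i)%N.
Proof. by []. Qed.

Lemma fps_coefCM a f n : (fpsC a * f) n = a * f n.
Proof.
rewrite fps_coefM big_ord_recl /= subn0 big1 ?addr0 // => i _.
by rewrite mul0r.
Qed.

Lemma fps_coef0X f k : (f ^+ k) 0%N = f 0%N ^+ k.
Proof.
elim: k => // k IHk.
by rewrite !exprS fps_coefM big_ord_recl big_ord0 addr0 IHk.
Qed.

(** With no constant term, [f] is divisible by t, hence [f ^+ k] by t^k. This makes the truncated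
    sums in [fps_exp] safe to lengthen. *)
Lemma fps_coefX_small f k n : f 0%N = 0 -> (n < k)%N -> (f ^+ k) n = 0.
Proof.
move=> f0; elim: k n => // k IHk n nk.
rewrite exprS fps_coefM big_ord_recl f0 mul0r add0r big1 // => i _.
rewrite IHk ?mulr0 //= /bump /= add1n.
apply: leq_trans (_ : n <= k)%N => //.
by rewrite ltn_subrL /= (leq_ltn_trans _ (ltn_ord i)).
Qed.

Lemma fps_derivD f g : D (f + g) = D f + D g.
Proof. by apply: fpsP => n /=; rewrite mulrnDl. Qed.

Lemma fps_derivN f : D (- f) = - D f.
Proof. by apply: fpsP => n /=; rewrite mulNrn. Qed.

Lemma fps_deriv0 : D 0 = 0.
Proof. by apply: fpsP => n /=; rewrite mul0rn. Qed.

Lemma fps_derivMn f k : D (f *+ k) = D f *+ k.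
Proof. by elim: k => [|k IHk]; rewrite ?fps_deriv0 // !mulrS fps_derivD IHk. Qed.

Lemma fps_derivMz f (k : int) : D (f *~ k) = D f *~ k.
Proof.
by case: k => k; rewrite ?NegzE ?mulrNz -!pmulrn ?fps_derivN fps_derivMn.
Qed.

Lemma fps_deriv_sum (I : Type) (s : seq I) (P : pred I) (F : I -> fps R) :
  D (\sum_(i <- s | P i) F i) = \sum_(i <- s | P i) D (F i).
Proof. exact: (big_morph D fps_derivD fps_deriv0). Qed.

Lemma fps_derivC a : D (fpsC a) = 0.
Proof. by apply: fpsP => n /=; rewrite mul0rn. Qed.

Lemma fps_deriv1 : D 1 = 0.
Proof. exact: fps_derivC. Qed.

Lemma fps_derivT : D fpsT = 1.
Proof. by apply: fpsP => -[|n] /=; rewrite ?mulr1n ?mul0rn. Qed.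

Lemma fps_derivM f g : D (f * g) = D f * g + f * D g.
Proof.
apply: fpsP => n; rewrite fps_coefD !fps_coefM /=.
(* The Leibniz rule on monomials: the factor n + 1 is split as i + (n + 1 - i). *)
transitivity (\sum_(i < n.+2) (f i *+ i * g (n.+1 - i)%N +
                               f i * g (n.+1 - i)%N *+ (n.+1 - i))).
  rewrite -sumrMnl; apply: eq_bigr => i _.
  by rewrite mulrnAl -mulrnDr subnKC // -ltnS.
rewrite big_split /=; congr (_ + _).
  by rewrite big_ord_recl mulr0n mul0r add0r.
rewrite big_ord_recr /= subnn mulr0n addr0.
by apply: eq_bigr => i _; rewrite subSn ?leq_ord // mulrnAr.
Qed.

Lemma fps_derivX f k : D (f ^+ k.+1) = (D f * f ^+ k) *+ k.+1.
Proof.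
elim: k => [|k IHk]; first by rewrite expr1 mulr1 mulr1n.
by rewrite exprS fps_derivM IHk mulrnAr mulrCA -exprS -mulrS.
Qed.

(** Taylor's formula, through which a coefficient is read off as a value at t = 0. *)
Lemma iter_fps_deriv_coef0 f n : iter n D f 0%N = f n *+ n`!.
Proof.
elim: n f => [|n IHn] f; first by rewrite mulr1n.
by rewrite iterSr IHn /= -mulrnA factS.
Qed.

End FpsDeriv.

(** * The exponential series and its derivative *)

Section FpsExpDeriv.
Variables (F : fieldType) (A : comAlgType F).
Hypothesis char0 : [pchar F] =i pred0.
Local Notation D := (@fps_deriv A).

Lemma natF_neq0 n : (0 < n)%N -> n%:R != 0 :> F.
Proof. by case: n => // n _; move/pcharf0P: char0 => ->. Qed.

Lemma fps_exp_coef0 (f : fps A) : fps_exp f 0%N = 1.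
Proof. by rewrite /= big_ord_recl big_ord0 addr0 invr1 scale1r expr0. Qed.

Lemma fps_deriv_exp (f : fps A) :
  f 0%N = 0 -> D (fps_exp f) = D f * fps_exp f.
Proof.
move=> f0; apply: fpsP => n.
rewrite fps_coefM /= -sumrMnl big_ord_recl /= scaler0 mul0rn add0r.
(* Termwise, D (f^(j+1)) / (j+1)! = D f * f^j / j!; cancelling j + 1 uses characteristic 0. *)
transitivity (\sum_(j < n.+1) (j`!%:R^-1 : F) *: (D f * f ^+ j) n).
  apply: eq_bigr => j _.
  rewrite scalerMnr /bump leq0n add1n -[_ *+ n.+1]/(D (f ^+ j.+1) n) fps_derivX fps_coefMn.
  rewrite -scaler_nat scalerA; congr (_ *: _).
  by rewrite factS natrM invfM mulrAC mulVf ?mul1r ?natF_neq0.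
(* The inner sum stops at n - i. It is padded to the common length n + 1 so that the sums can be
   exchanged; the added terms vanish by [fps_coefX_small]. *)
under [RHS]eq_bigr => i _.
  rewrite mulr_sumr.
  under eq_bigr => j _ do rewrite -scalerAr.
  rewrite (big_ord_widen n.+1 (fun j => (j`!%:R^-1 : F) *:
    (D f i * (f ^+ j) (n - i)%N))) ?ltnS ?leq_subr // big_mkcond /=.
  over.
rewrite exchange_big; apply: eq_bigr => j _.
rewrite fps_coefM scaler_sumr; apply: eq_bigr => i _ /=.
case: ifPn => //; rewrite -leqNgt => lt_ni.
by rewrite fps_coefX_small // mulr0 scaler0.
Qed.

Lemma fps_deriv_expT : D (fps_exp fpsT) = fps_exp fpsT.
Proof. by rewrite fps_deriv_exp // fps_derivT mul1r. Qed.

End FpsExpDeriv.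

(** * Constant-coefficient differential operators *)

(* (X - c)^{\underline k}, that is (X - c)(X - c - 1)...(X - c - k + 1) *)
Definition fallp (c k : nat) : {poly int} := \prod_(i < k) ('X - (c + i)%:R).

Lemma fallpS c k : fallp c k.+1 = fallp c k * ('X - (c + k)%:R).
Proof. by rewrite /fallp big_ord_recr. Qed.

Lemma size_fallp c k : size (fallp c k) = k.+1.
Proof.
elim: k => [|k IHk]; first by rewrite /fallp big_ord0 size_poly1.
rewrite fallpS -polyC_natr size_mul ?polyXsubC_eq0 -?size_poly_eq0 ?IHk //.
by rewrite size_XsubC addn2.
Qed.

Section DerivPoly.
Variable R : comNzRingType.
Implicit Types (f : fps R) (p q : {poly int}).
Local Notation D := (@fps_deriv R).

(* p(d/dt) f *)
Definition deriv_poly p f : fps R := \sum_(i < size p) iter i D f *~ p`_i.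

Lemma deriv_polyE n p f : (size p <= n)%N ->
  deriv_poly p f = \sum_(i < n) iter i D f *~ p`_i.
Proof.
move=> le_pn; rewrite /deriv_poly (big_ord_widen n (fun i => iter i D f *~ p`_i)) //.
rewrite big_mkcond; apply: eq_bigr => i _ /=.
by case: ltnP => // le_pi; rewrite nth_default ?mulr0z.
Qed.

Lemma deriv_polyD p q f : deriv_poly (p + q) f = deriv_poly p f + deriv_poly q f.
Proof.
rewrite !(@deriv_polyE (maxn (size p) (size q))) ?leq_maxl ?leq_maxr //; last first.
  exact: size_polyD.
by rewrite -big_split; apply: eq_bigr => i _; rewrite coefD mulrzDr.
Qed.

Lemma deriv_poly0 f : deriv_poly 0 f = 0.
Proof. by rewrite /deriv_poly size_poly0 big_ord0. Qed.

Lemma deriv_poly1 f : deriv_poly 1 f = f.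
Proof. by rewrite /deriv_poly size_poly1 big_ord1 coef1. Qed.

Lemma deriv_polyN p f : deriv_poly (- p) f = - deriv_poly p f.
Proof.
by apply/eqP; rewrite -subr_eq0 opprK -deriv_polyD addNr deriv_poly0.
Qed.

Lemma deriv_polyMn p k f : deriv_poly (p *+ k) f = deriv_poly p f *+ k.
Proof.
by elim: k => [|k IHk]; rewrite ?deriv_poly0 // !mulrS deriv_polyD IHk.
Qed.

Lemma deriv_poly_sum (I : Type) (s : seq I) (P : pred I) (Q : I -> {poly int}) f :
  deriv_poly (\sum_(i <- s | P i) Q i) f =
  \sum_(i <- s | P i) deriv_poly (Q i) f.
Proof.
by apply: (big_morph (deriv_poly^~ f)) => [p q|]; rewrite ?deriv_polyD ?deriv_poly0.
Qed.

Lemma deriv_polyXM p f : deriv_poly ('X * p) f = D (deriv_poly p f).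
Proof.
rewrite (@deriv_polyE (size p).+1) ?(leq_trans (size_polyMleq _ _)) ?size_polyX //.
rewrite big_ord_recl coefXM mulr0z add0r fps_deriv_sum.
by apply: eq_bigr => i _; rewrite fps_derivMz coefXM.
Qed.

Lemma deriv_polyXnM n p f : deriv_poly ('X^n * p) f = iter n D (deriv_poly p f).
Proof.
by elim: n => [|n IHn]; rewrite ?expr0 ?mul1r // exprS -mulrA deriv_polyXM IHn.
Qed.

(* On solutions of E' = (w + a) E, where w' = w, the operator D - a - k sends
   w^k E to w^(k+1) E. *)
Lemma deriv_fallp (w E : fps R) (a k : nat) :
    D w = w -> D E = (w + a%:R) * E -> deriv_poly (fallp a k) E = w ^+ k * E.
Proof.
move=> Dw DE.
have DX j : D (w ^+ j) = w ^+ j *+ j.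
  by case: j => [|j]; rewrite ?fps_deriv1 // fps_derivX Dw -exprS.
elim: k => [|k IHk]; first by rewrite /fallp big_ord0 deriv_poly1 mul1r.
(* D (w^k E) = k w^k E + w^k (w + a) E, and subtracting (a + k) w^k E leaves w^(k+1) E. *)
rewrite fallpS mulrC mulrBl deriv_polyD deriv_polyXM deriv_polyN mulr_natl.
rewrite deriv_polyMn IHk fps_derivM DX DE mulrDl mulrDr mulrA -exprSr.
by rewrite mulr_natl mulrnAr mulrnAl addrCA mulrnDr [_ *+ k + _]addrC addrK.
Qed.

End DerivPoly.

(** * Coefficients of falling factorials *)

Section PermutationCycles.

(** The lifted permutation fixes 0 and acts as [s] on the other points, so its cycles are those of
    [s], shifted, and the singleton of 0. *)
Lemma card_porbits_lift_perm n (s : 'S_n) :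
  #|porbits (lift_perm ord0 ord0 s)| = #|porbits s|.+1.
Proof.
set t := lift_perm ord0 ord0 s.
have tX k i : (t ^+ k)%g (lift ord0 i) = lift ord0 ((s ^+ k)%g i).
  elim: k => [|k IHk]; first by rewrite !perm1.
  by rewrite !expgSr !permM IHk lift_perm_lift.
have tX0 k : (t ^+ k)%g ord0 = ord0.
  by elim: k => [|k IHk]; rewrite ?perm1 // expgSr permM IHk lift_perm_id.
have orbit0 : porbit t ord0 = [set ord0].
  apply/setP => x; rewrite inE; apply/porbitP/eqP => [[k ->] // | ->].
  by exists 0%N; rewrite tX0.
have orbit_lift i : porbit t (lift ord0 i) = lift ord0 @: porbit s i.
  apply/setP => x; apply/porbitP/imsetP => [[k ->] | [y /porbitP[k ->] ->]].
    by exists ((s ^+ k)%g i); rewrite ?tX // mem_porbit.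
  by exists k; rewrite tX.
have -> : porbits t =
    [set ord0] |: [set lift ord0 @: (B : {set 'I_n}) | B in porbits s].
  apply/setP => B; rewrite 2!inE; apply/imsetP/orP.
    case=> x _ ->; case: (unliftP ord0 x) => [j|] ->.
      by right; rewrite orbit_lift imset_f // imset_f.
    by left; rewrite orbit0.
  case=> [/eqP-> | /imsetP[C /imsetP[i _ ->] ->]]; first by exists ord0.
  by exists (lift ord0 i).
rewrite cardsU1 card_imset; last exact/imset_inj/lift_inj.
case: imsetP => // -[B _ eqB].
have : ord0 \in lift ord0 @: B by rewrite -eqB set11.
by case/imsetP.
Qed.

Definition risep (n : nat) : {poly int} := \prod_(i < n) ('X + i%:R).

(** Each permutation of n + 1 points is uniquely a transposition (i 0) times a permutation fixing 0.
    The choice i = 0 gives an extra cycle, hence a factor X; each of the n others inserts 0 into an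
    existing cycle, hence the summand n. *)
Lemma risepE n : risep n = \sum_(s : 'S_n) 'X^#|porbits s|.
Proof.
elim: n => [|n IHn].
  rewrite /risep big_ord0 (big_pred1 1%g) => [|s].
    rewrite (_ : porbits _ = set0) ?cards0 ?expr0 //.
    by apply/eqP/set0Pn => -[B /imsetP[[]]].
  by apply/esym/eqP/permP => -[].
rewrite /risep big_ord_recr -/(risep n) {}IHn /=.
pose h (u : 'I_n.+1 * 'S_n) := (tperm u.1 ord0 * lift_perm ord0 ord0 u.2)%g.
have hK : injective h.
  move=> [i s] [j t] eq_st.
  (* The index i is recovered as the preimage of 0 under [h (i, s)]. *)
  have eq_ij : i = j.
    move: (congr1 (fun v : 'S_n.+1 => (v^-1)%g ord0) eq_st).
    by rewrite /h !invMg /= !permM !lift_permV !lift_perm_id !tpermV !tpermR.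
  move: eq_st; rewrite /h /= {}eq_ij => /mulgI eq_st; congr (_, _).
  apply/permP => k; move/permP/(_ (lift ord0 k)): eq_st.
  by rewrite !lift_perm_lift => /lift_inj.
have hb : bijective h.
  by apply: inj_card_bij hK _; rewrite card_prod !card_Sn card_ord factS.
rewrite [RHS](reindex h) /=; last exact: onW_bij hb.
rewrite -(pair_bigA _ (fun i s => 'X^(#|porbits (h (i, s))|))) /= exchange_big mulr_suml.
apply: eq_bigr => s _; rewrite big_ord_recl /h /= tperm1 mul1g.
rewrite card_porbits_lift_perm exprSr mulrDr; congr (_ + _).
rewrite -[n in n%:R]card_ord -sumr_const mulr_sumr; apply: eq_bigr => i _.
rewrite mulr1; congr 'X^_.
(* A transposition of points from two distinct cycles merges these cycles. *)
have := porbits_mul_tperm (lift_perm ord0 ord0 s) (lift ord0 i) ord0.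
rewrite card_porbits_lift_perm /=.
have -> : lift ord0 i \notin porbit (lift_perm ord0 ord0 s) ord0.
  apply/porbitP => -[k].
  have -> : (lift_perm ord0 ord0 s ^+ k)%g ord0 = ord0 => //.
  elim: k => [|k IHk]; first by rewrite perm1.
  by rewrite expgSr permM IHk lift_perm_id.
by rewrite /= addn2 addn1 => -[].
Qed.

End PermutationCycles.

(** * Coefficients of products of rising and falling factorials *)

Section FallingCoefficients.

Lemma coef_risep n k : (risep n)`_k = (stirling1 n k)%:Z.
Proof.
rewrite risepE coef_sum /stirling1 cardsE -sum1_card -natz natr_sum [RHS]big_mkcond.
apply: eq_bigr => s _; rewrite coefXn eq_sym unfold_in -[eqn _ _]/(_ == _).
by case: (_ == _).
Qed.

(** Multiplication is compatible with congruence modulo X^(k+1). *)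
Lemma coef_prod_trunc (R : comNzRingType) (n k : nat) (P Q : 'I_n -> {poly R}) :
    (forall i j, (j <= k)%N -> (P i)`_j = (Q i)`_j) ->
  (\prod_i P i)`_k = (\prod_i Q i)`_k.
Proof.
move=> eqPQ.
suff H j : (j <= k)%N -> (\prod_i P i)`_j = (\prod_i Q i)`_j by apply: H.
move: j; pose eq_trunc (p q : {poly R}) := forall j, (j <= k)%N -> p`_j = q`_j.
apply: (big_ind2 eq_trunc) => // [|i _ j];
  last exact: eqPQ.
move=> p1 p2 q1 q2 eq_p eq_q j le_jk; rewrite !coefM; apply: eq_bigr => i _.
by rewrite eq_p ?eq_q // (leq_trans _ le_jk) ?leq_subr ?leq_ord.
Qed.

(** Only degrees up to k matter, so each factor is replaced by its truncation; distributing the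
    product over these finite sums gives the tuples of [acoef]. *)
Lemma coef_prod (R : comNzRingType) (n k : nat) (P : 'I_n -> {poly R}) :
  (\prod_i P i)`_k =
  \sum_(j : {ffun 'I_n -> 'I_k.+1} | (\sum_i j i)%N == k) \prod_i (P i)`_(j i).
Proof.
rewrite (@coef_prod_trunc _ _ _ _ (fun i => \sum_(j < k.+1) (P i)`_j *: 'X^j)).
  rewrite bigA_distr_bigA coef_sum [RHS]big_mkcond; apply: eq_bigr => j _ /=.
  rewrite scaler_prod -(big_morph (fun m => 'X^m) (@exprD _ 'X) (expr0 _)).
  by rewrite coefZ coefXn eq_sym; case: eqP; rewrite ?mulr1 ?mulr0.
by move=> i j le_jk; rewrite -poly_def coef_poly ltnS le_jk.
Qed.

(** Substituting -X turns each factor X + i into -(X - i). *)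
Lemma fallp0E n : fallp 0 n = (-1) ^+ n * (risep n \Po - 'X).
Proof.
elim: n => [|n IHn]; first by rewrite /fallp /risep !big_ord0 comp_polyC mul1r.
rewrite fallpS IHn /risep big_ord_recr /= -/(risep n) comp_polyM comp_polyD.
rewrite comp_polyX -polyC_natr comp_polyC polyC_natr exprSr -!mulrA.
by congr (_ * _); rewrite mulN1r -mulrN opprD opprK.
Qed.

Lemma prod_fallp0E s :
  \prod_(b <- s) fallp 0 b =
  (-1) ^+ sumn s * ((\prod_(b <- s) risep b) \Po - 'X).
Proof.
elim: s => [|b s IHs]; first by rewrite !big_nil comp_polyC mul1r.
by rewrite !big_cons fallp0E IHs comp_polyM /= exprD mulrACA.
Qed.

Lemma coef_comp_polyNX (p : {poly int}) k : (p \Po - 'X)`_k = (-1) ^+ k * p`_k.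
Proof.
rewrite coef_comp_poly.
transitivity (\sum_(i < size p | i == k :> nat) (-1) ^+ i * p`_i).
  rewrite [RHS]big_mkcond; apply: eq_bigr => i _.
  rewrite -scaleN1r exprZn coefZ coefXn eq_sym mulrCA.
  by case: eqP => _; rewrite ?mulr1 ?mulr0.
rewrite (big_ord1_eq _ (fun i => (-1) ^+ i * p`_i)).
by case: ltnP => // le_pk; rewrite nth_default ?mulr0.
Qed.

Lemma coef_prod_fallp s k : (k <= sumn s)%N ->
  (\prod_(b <- s) fallp 0 b)`_k = acoef s k.
Proof.
move=> le_ks; rewrite /acoef.
under [X in _ = _ * X]eq_bigr do under eq_bigr do rewrite -coef_risep.
rewrite -(coef_prod k (fun i : 'I_(size s) => risep (nth 0%N s i))).
rewrite prod_fallp0E (big_nth 0%N) big_mkord.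
have -> : (-1) ^+ sumn s = ((-1) ^+ sumn s)%:P :> {poly int}.
  by rewrite rmorphXn rmorphN1.
(* The sign is (-1)^([sumn s] + k); since k is at most [sumn s], the natural-number difference
   [sumn s - k] has the same parity. *)
rewrite coefCM coef_comp_polyNX mulrA -exprD -[in LHS]signr_odd oddD -oddB //.
by rewrite signr_odd.
Qed.

Lemma size_prod_fallp s : size (\prod_(b <- s) fallp 0 b) = (sumn s).+1.
Proof.
elim: s => [|b s IHs]; first by rewrite big_nil size_poly1.
rewrite big_cons size_mul -?size_poly_eq0 ?size_fallp ?IHs //.
by rewrite addSn addnS.
Qed.

End FallingCoefficients.

(** * Partitions and block-injective maps *)

Section InjectiveOnBlocks.

(** At [f := pblock P] this is literally the separation condition of [rstirling2], so one predicate
    serves both maps and partitions. *)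
Definition inj_blocks (T : eqType) N (r : seq nat) (f : 'I_N -> T) :=
  [forall i : 'I_(size r), forall x in rblock N r i,
     forall y in rblock N r i, (x != y) ==> (f x != f y)].

Lemma inj_blocksP (T : eqType) N r (f : 'I_N -> T) :
  reflect (forall i, {in rblock N r i &, injective f}) (inj_blocks r f).
Proof.
apply: (iffP forallP) => [inj_f i x y xi yi eq_fxy | inj_f i].
  (* Past the end of [r] both prefixes are all of [r], so the block is empty. *)
  have [lt_ir|le_ri] := ltnP i (size r); last first.
    by move: xi; rewrite inE !take_oversize ?(leqW le_ri) // leqNgt andNb.
  apply/eqP; apply: contraT => ne_xy.
  have /forall_inP/(_ x xi)/forall_inP/(_ y yi) := inj_f (Ordinal lt_ir).
  by rewrite ne_xy eq_fxy eqxx.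
apply/forall_inP => x xi; apply/forall_inP => y yi; apply/implyP.
by apply: contra => /eqP/(inj_f i x y xi yi)->.
Qed.

Lemma rblock_lshift0 a N r (x : 'I_a) : lshift N x \in rblock (a + N) (a :: r) 0.
Proof. by rewrite inE /= take0 /= addn0 ltn_ord. Qed.

Lemma rblock_rshift0 a N r (x : 'I_N) :
  (rshift a x \in rblock (a + N) (a :: r) 0) = false.
Proof. by rewrite inE /= take0 /= addn0 ltnNge leq_addr. Qed.

Lemma rblock_lshiftS a N r i (x : 'I_a) :
  (lshift N x \in rblock (a + N) (a :: r) i.+1) = false.
Proof. by rewrite inE /= leqNgt (leq_trans (ltn_ord x)) ?leq_addr. Qed.

Lemma rblock_rshiftS a N r i (x : 'I_N) :
  (rshift a x \in rblock (a + N) (a :: r) i.+1) = (x \in rblock N r i).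
Proof. by rewrite !inE /= leq_add2l ltn_add2l. Qed.

Lemma inj_blocks_cons (T : eqType) a N r (f : 'I_(a + N) -> T) :
  inj_blocks (a :: r) f =
  injectiveb (f \o lshift N) && inj_blocks r (f \o @rshift a N).
Proof.
apply/inj_blocksP/andP => [inj_f | [/injectiveP inj_l /inj_blocksP inj_r] [|i] x y].
- split; first apply/injectiveP => x y /= eq_fxy.
    exact/(@lshift_inj a N)/(inj_f 0%N _ _ (rblock_lshift0 _ _ _) (rblock_lshift0 _ _ _)).
  apply/inj_blocksP => i x y xi yi eq_fxy; apply: (@rshift_inj a N).
  by apply: (inj_f i.+1) eq_fxy; rewrite rblock_rshiftS.
- case: (split_ordP x) => x' ->; case: (split_ordP y) => y' ->;
    rewrite ?rblock_rshift0 // => _ _ eq_f.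
  by rewrite (inj_l x' y').
case: (split_ordP x) => x' ->; case: (split_ordP y) => y' ->;
  rewrite ?rblock_lshiftS // !rblock_rshiftS => xi yi eq_f.
by rewrite (inj_r i x' y').
Qed.

Lemma inj_blocks_nil (T : eqType) N (f : 'I_N -> T) : inj_blocks [::] f.
Proof. by apply/inj_blocksP => i x y; rewrite inE ltn0 andbF. Qed.

(** Blocks are peeled off the front: the first contributes an injection, chosen independently of the
    rest, and the n points after the last block are free. *)
Lemma card_inj_blocks x N n r : N = (n + sumn r)%N ->
  #|[set f : {ffun 'I_N -> 'I_x} | inj_blocks r f]| =
  (x ^ n * \prod_(b <- r) x ^_ b)%N.
Proof.
elim: r N => [|a r IHr] N /=.
  rewrite addn0 big_nil muln1 => ->.
  rewrite -[in RHS](card_ord x) -[n in RHS]card_ord -card_ffun -cardsT.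
  by apply: eq_card => f; rewrite !inE inj_blocks_nil.
rewrite addnCA => ->; set M := (n + sumn r)%N; rewrite big_cons mulnCA.
rewrite -(IHr M) // -[in x ^_ a](card_ord x) -[a in _ ^_ a]card_ord -card_inj_ffuns -cardsX.
pose h (f : {ffun 'I_(a + M) -> 'I_x}) :=
  ([ffun i => f (lshift M i)], [ffun j => f (rshift a j)]).
pose g (u : {ffun 'I_a -> 'I_x} * {ffun 'I_M -> 'I_x}) :=
  [ffun k => match split k with inl i => u.1 i | inr j => u.2 j end].
have hK : cancel h g.
  move=> f; apply/ffunP => k; rewrite ffunE.
  by case: (split_ordP k) => j -> /=; rewrite ffunE.
have gK : cancel g h.
  move=> [u v]; congr (_, _); apply/ffunP => k; rewrite !ffunE.
    by rewrite (unsplitK (inl k)).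
  by rewrite (unsplitK (inr k)).
rewrite -(on_card_preimset (onW_bij _ (Bijective hK gK))).
apply: eq_card => f; rewrite !inE inj_blocks_cons; congr (_ && _).
  by apply: eq_injectiveb => i /=; rewrite ffunE.
by apply/inj_blocksP/inj_blocksP => inj_f i x1 x2 x1i x2i /= eq_f;
   apply: (inj_f i) => //; move: eq_f; rewrite /= !ffunE.
Qed.

End InjectiveOnBlocks.

(** * Kernel partitions of maps *)

Section PreimPartition.
Variables T rT : finType.

Lemma eq_preim_partition (T1 T2 : eqType) (f : T -> T1) (g : T -> T2) (D : {set T}) :
    (forall x y, (f x == f y) = (g x == g y)) ->
  preim_partition f D = preim_partition g D.
Proof.
move=> eq_fg; apply: eq_imset => x; apply/setP => y.
by rewrite !inE eq_fg.
Qed.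

Lemma eq_pblock_preim (T1 : eqType) (f : T -> T1) x y :
  (pblock (preim_partition f setT) x == pblock (preim_partition f setT) y) =
  (f x == f y).
Proof.
have /and3P[/eqP cover_f triv_f _] := preim_partitionP f [set: T].
rewrite eq_pblock ?cover_f ?inE // pblock_equivalence_partition ?inE //.
by move=> a b c _ _ _; split=> [|/eqP-> //]; rewrite ?eqxx.
Qed.

(** A map with kernel partition [P] amounts to an injection from the set of blocks of [P] into
    [rT]. *)
Lemma card_preim_partition_fiber (P : {set {set T}}) : partition P setT ->
  #|[set f : {ffun T -> rT} | preim_partition f setT == P]| = #|rT| ^_ #|P|.
Proof.
move=> partP; have /and3P[/eqP coverP trivP set0P] := partP.
have memP y : pblock P y \in P by rewrite pblock_mem ?coverP.
pose b y : {B | B \in P} := exist _ (pblock P y) (memP y).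
have b_eq y y' : (b y == b y') = (pblock P y == pblock P y') by [].
(* Nonempty blocks provide the representatives used to descend a map to the blocks. *)
have b_surj u : exists y, b y == u.
  case: u => B BP; have /set0Pn[y yB] : B != set0 by apply: contraNneq set0P => <-.
  by exists y; rewrite -val_eqE /= (def_pblock trivP BP yB).
rewrite -(card_sig (mem P)) -card_inj_ffuns.
pose h (g : {ffun {B | B \in P} -> rT}) := [ffun y => g (b y)].
rewrite -(@card_imset _ _ h) => [|g g' eq_h]; last first.
  apply/ffunP => u; case: (b_surj u) => y /eqP<-.
  by move/ffunP/(_ y): eq_h; rewrite !ffunE.
apply: eq_card => f; rewrite inE; apply/eqP/imsetP => [eq_fP | [g]].
  have f_eq y y' : (b y == b y') = (f y == f y').
    by rewrite b_eq -eq_fP eq_pblock_preim.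
  exists [ffun u => f (xchoose (b_surj u))].
    rewrite inE; apply/injectiveP => u u'; rewrite !ffunE => /eqP.
    by rewrite -f_eq (eqP (xchooseP (b_surj u))) (eqP (xchooseP (b_surj u'))) => /eqP.
  apply/ffunP => y; rewrite !ffunE; apply/eqP.
  by rewrite -f_eq eq_sym (xchooseP (b_surj (b y))).
rewrite inE => /injectiveP inj_g ->.
rewrite -[RHS](preim_partition_pblock partP).
by apply: eq_preim_partition => x y; rewrite !ffunE (inj_eq inj_g) b_eq.
Qed.

Lemma leq_card_partition (P : {set {set T}}) (D : {set T}) :
  partition P D -> (#|P| <= #|D|)%N.
Proof.
move=> partP; rewrite (card_partition partP) -sum1_card leq_sum // => B BP.
have /and3P[_ _ set0P] := partP; rewrite card_gt0.
by apply: contraNneq set0P => <-.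
Qed.

End PreimPartition.

(** Maps are sorted by kernel partition, which alone decides injectivity on the blocks R_i; a kernel
    with k blocks arises from [x ^_ k] maps. *)
Lemma card_inj_blocks_rstirling2 x N r :
  #|[set f : {ffun 'I_N -> 'I_x} | inj_blocks r f]| =
  (\sum_(k < N.+1) rstirling2 r N k * x ^_ k)%N.
Proof.
pose ker (f : {ffun 'I_N -> 'I_x}) := preim_partition f setT.
have ker_inj f : inj_blocks r (pblock (ker f)) = inj_blocks r f.
  by apply/inj_blocksP/inj_blocksP => inj_f i a b ai bi /eqP eq_f;
     apply: (inj_f i) => //; apply/eqP; rewrite ?eq_pblock_preim //
     -eq_pblock_preim.
pose good (P : {set {set 'I_N}}) := partition P setT && inj_blocks r (pblock P).
rewrite -sum1_card (partition_big ker good) => [|f] /=; last first.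
  by rewrite inE /good preim_partitionP ker_inj.
(* Kernels are grouped by number of blocks; [inord] loses nothing, as a partition of N points has at
   most N blocks. *)
rewrite (partition_big (fun P : {set {set 'I_N}} => inord #|P| : 'I_N.+1) xpredT) //=.
apply: eq_bigr => k _; rewrite /rstirling2 -sum_nat_const.
rewrite [LHS](eq_bigl (fun P => P \in [set P | [&& partition P [set: 'I_N], #|P| == k &
  inj_blocks r (pblock P)]])) => [|P]; last first.
  rewrite !inE /good andbAC -andbA; case partP: (partition P _) => //=; congr (_ && _).
  have := leq_card_partition partP; rewrite cardsT card_ord => le_PN.
  by rewrite -val_eqE /= inordK // ltnS.
apply: eq_bigr => P; rewrite inE => /and3P[partP /eqP <- goodP].
rewrite sum1dep_card -[x in RHS]card_ord -card_preim_partition_fiber //.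
apply: eq_card => f; rewrite !inE; case: eqP => [eq_fP | _]; rewrite ?andbF //.
by rewrite -ker_inj eq_fP goodP.
Qed.

(** * Bell polynomials *)

Lemma ffact_rstirling2 x n r :
  (x ^ n * \prod_(b <- r) x ^_ b =
   \sum_(k < (n + sumn r).+1) rstirling2 r (n + sumn r) k * x ^_ k)%N.
Proof. by rewrite -card_inj_blocks_rstirling2 (@card_inj_blocks _ _ n). Qed.

(** The double count is evaluated at x = k: the factor [k ^_ a] is 0, so every summand vanishes, in
    particular the one of index k, which is the Stirling number times k!. *)
Lemma rstirling2_small n s a k :
  (k < a)%N -> rstirling2 (rcons s a) (n + sumn (rcons s a)) k = 0%N.
Proof.
move=> lt_ka; have := ffact_rstirling2 k n (rcons s a).
rewrite big_rcons /= [in k ^_ a]ffact_small // muln0 muln0.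
have lt_kN : (k < (n + sumn (rcons s a)).+1)%N.
  by rewrite sumn_rcons ltnS addnA (leq_trans (ltnW lt_ka)) ?leq_addl.
rewrite (bigD1 (Ordinal lt_kN)) //= ffactnn => /esym/eqP.
by rewrite addn_eq0 muln_eq0 => /andP[/orP[/eqP //|]]; rewrite eqn0Ngt fact_gt0.
Qed.

Lemma ffactD y a k : ((y + a) ^_ (k + a) = (y + a) ^_ a * y ^_ k)%N.
Proof.
elim: k => [|k IHk]; first by rewrite muln1.
by rewrite addSn !ffactnSr IHk subnDr mulnA.
Qed.

(** The double count at x = y + a is divided by [(y + a) ^_ a], which is nonzero: terms of index
    below a vanish, and after the shift k to k + a the others contain this factor by [ffactD]. *)
Lemma ffact_rstirling2_rcons y n s a :
  ((y + a) ^ n * \prod_(b <- s) (y + a) ^_ b =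
   \sum_(k < (n + sumn s).+1)
     rstirling2 (rcons s a) (n + sumn (rcons s a)) (k + a) * y ^_ k)%N.
Proof.
apply/eqP; rewrite -(@eqn_pmul2l ((y + a) ^_ a)); last first.
  by rewrite ffact_gt0 leq_addl.
have := ffact_rstirling2 (y + a) n (rcons s a); rewrite big_rcons /= mulnA mulnC => ->.
rewrite -(big_mkord xpredT (fun k => rstirling2 _ _ k * (y + a) ^_ k)%N).
rewrite [in X in index_iota _ X]sumn_rcons addnA.
rewrite (@big_cat_nat _ _ _ a) ?leqW ?leq_addl //= big1_seq ?add0n; last first.
  by move=> k; rewrite mem_index_iota => /andP[_ lt_ka]; rewrite rstirling2_small.
rewrite -[X in index_iota X]add0n big_addn -addSn addnK big_mkord big_distrr /=.
by apply/eqP/eq_bigr => k _; rewrite ffactD mulnCA.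
Qed.

(** Otherwise the difference would have as many distinct roots as its size, which exceeds its
    degree. *)
Lemma poly_int_eq c (p q : {poly int}) :
  (forall y : nat, p.[(y + c)%:R] = q.[(y + c)%:R]) -> p = q.
Proof.
move=> eq_pq; apply/eqP; rewrite -subr_eq0; apply: contraT => nz_pq.
pose rs : seq int := [seq (y + c)%:R | y <- iota 0 (size (p - q)%R)].
suff: (size rs < size (p - q)%R)%N by rewrite size_map size_iota ltnn.
apply: max_poly_roots => //.
  by apply/allP => _ /mapP[y _ ->]; rewrite rootE !hornerE eq_pq subrr.
rewrite map_inj_uniq ?iota_uniq // => x y /eqP.
by rewrite !natz eqz_nat eqn_add2r => /eqP.
Qed.

Lemma horner_fallp c k y : (fallp c k).[(y + c)%:R] = (y ^_ k)%:R.
Proof.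
elim: k => [|k IHk]; first by rewrite /fallp big_ord0 hornerE.
rewrite fallpS hornerM IHk -polyC_natr hornerXsubC ffactnSr natrM.
(* If y < k the truncated y - k is wrong as an integer, but both sides carry the factor [y ^_ k] =
   0. *)
have [le_ky | lt_yk] := leqP k y; last by rewrite ffact_small ?mul0r.
by rewrite -natrB ?[(c + k)%N]addnC ?leq_add2r // subnDr.
Qed.

(* At X = y + a, after multiplication by (y + a) ^_ a, both sides count maps
   into a set of size y + a. *)
Lemma fallp_rstirling2 n s a :
  'X^n * \prod_(b <- s) fallp 0 b =
  \sum_(k < (n + sumn s).+1)
    fallp a k *+ rstirling2 (rcons s a) (n + sumn (rcons s a)) (k + a).
Proof.
apply: (@poly_int_eq a) => y.
rewrite hornerM hornerXn horner_prod horner_sum.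
under eq_bigr do rewrite -[(y + a)%N]addn0 horner_fallp.
rewrite -natr_prod -natrX -natrM ffact_rstirling2_rcons natr_sum.
by apply: eq_bigr => k _; rewrite hornerMn horner_fallp natrM mulr_natl.
Qed.

(** * Bell polynomials through differential operators *)

Section RBellSeries.
Variables (R : comNzRingType) (s : seq nat) (a : nat).
Local Notation r := (rcons s a).

Lemma rinit_rcons : rinit r = s.
Proof. by rewrite /rinit size_rcons -cats1 take_size_cat. Qed.

Lemma rlast_rcons : rlast r = a.
Proof. by rewrite /rlast last_rcons. Qed.

(** In the falling factorial basis shifted by a, each basis operator acts on [E] as multiplication
    by a power of [w]. *)
Lemma deriv_poly_rbell (w E : fps R) m :
    fps_deriv w = w -> fps_deriv E = (w + a%:R) * E ->
  deriv_poly ('X^m * \prod_(b <- s) fallp 0 b) E = rbell r m w * E.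
Proof.
move=> Dw DE; rewrite (fallp_rstirling2 _ _ a) deriv_poly_sum.
rewrite /rbell rinit_rcons rlast_rcons mulr_suml.
by apply: eq_bigr => k _; rewrite deriv_polyMn (deriv_fallp _ Dw DE) mulrnAl.
Qed.

(** The same operator, now expanded in powers of D. *)
Lemma deriv_poly_acoef (E : fps R) m :
  deriv_poly ('X^m * \prod_(b <- s) fallp 0 b) E =
  \sum_(k < (sumn s).+1) iter (m + k) (@fps_deriv R) E *~ acoef s k.
Proof.
rewrite deriv_polyXnM (@deriv_polyE _ (sumn s).+1) ?size_prod_fallp //.
elim: m => [|m IHm] /=.
  by apply: eq_bigr => k _; rewrite coef_prod_fallp // -ltnS.
by rewrite IHm fps_deriv_sum; apply: eq_bigr => k _; rewrite fps_derivMz.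
Qed.

Lemma rbell_coef0 (w : fps R) m : rbell r m w 0%N = rbell r m (w 0%N).
Proof.
rewrite /rbell fps_coef_sum; apply: eq_bigr => k _.
by rewrite fps_coefMn fps_coef0X.
Qed.

End RBellSeries.

Theorem theorem5 (F : fieldType) (char0 : [pchar F] =i pred0)
    (A : comAlgType F) (z : A) (p : nat) (r : p.-tuple nat) (m : nat)
    (p_ge1 : (1 <= p)%N) (r_nondecreasing : sorted leq r) :
  let E : fps A :=
    fps_exp (fpsC z * (fps_exp fpsT - 1) + fpsT *+ rlast r) in
  egf (fun n => rbell r (n + m) z) = rbell r m (fpsC z * fps_exp fpsT) * E
  /\
  rbell r m (fpsC z * fps_exp fpsT) * E =
    \sum_(k < (sumn (rinit r)).+1)
      iter (m + k) (@fps_deriv A) E *~ acoef (rinit r) k.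

Proof.
(* Since p is at least 1, the tuple has a last entry to split off. *)
have [s [a def_r]] : exists s a, tval r = rcons s a.
  case: (lastP (tval r)) (size_tuple r) => [p0 | s a _]; last by exists s, a.
  by rewrite -p0 in p_ge1.
rewrite /= def_r rlast_rcons rinit_rcons.
set w := fpsC z * fps_exp fpsT; set E := fps_exp _.
have Dw : fps_deriv w = w.
  by rewrite fps_derivM fps_derivC mul0r add0r (fps_deriv_expT _ char0).
have w0 : w 0%N = z by rewrite fps_coefCM fps_exp_coef0 mulr1.
have DE : fps_deriv E = (w + a%:R) * E.
  (* The exponent has constant term z(1 - 1) + 0 = 0, as the chain rule requires. *)
  rewrite (fps_deriv_exp char0); last first.
    by rewrite fps_coefD fps_coefCM fps_coefD fps_exp_coef0 fps_coefN subrr mulr0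
               add0r fps_coefMn mul0rn.
  rewrite fps_derivD fps_derivMn fps_derivT fps_derivM fps_derivC mul0r add0r.
  rewrite fps_derivD fps_derivN fps_deriv1 subr0 (fps_deriv_expT _ char0).
  by congr (_ * _).
split; last first.
  by rewrite -(deriv_poly_rbell _ m Dw DE) deriv_poly_acoef.
apply: fpsP => n; set g := _ * E.
have iter_g : iter n (@fps_deriv A) g 0%N = rbell (rcons s a) (n + m) z.
  (* The n derivatives are absorbed into X^m, giving the operator for n + m; at t = 0, [E] is 1 and
     [w] is z. *)
  rewrite /g -(deriv_poly_rbell _ m Dw DE) -deriv_polyXnM mulrA -exprD.
  rewrite (deriv_poly_rbell _ _ Dw DE) fps_coefM big_ord1 fps_exp_coef0 mulr1.
  by rewrite rbell_coef0 w0.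
rewrite /= -iter_g iter_fps_deriv_coef0 -scaler_nat scalerA mulVf ?scale1r //.
by rewrite natF_neq0 ?fact_gt0.
Qed.
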